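(* Let $d$ be a positive integer and let $\{\mathbb{P}_n\}_{n\ge 0}$ and $\{\mathbb{Q}_n\}_{n\ge 0}$ be two monic orthogonal polynomial systems in $d$ variables which are linearly related by $$\mathbb{Q}_n=\mathbb{P}_n+M_n\,\mathbb{P}_{n-1},\qquad n\ge 1,\qquad \mathbb{Q}_0=\mathbb{P}_0,$$ where $M_n$ is a constant real matrix of size $r_n^d\times r_{n-1}^d$ for each $n\ge 1$. Then: (i) if $\operatorname{rank} M_1=0$, then $\operatorname{rank} M_n=0$ for every $n\ge 1$; (ii) if $\operatorname{rank} M_1=1$, then $\operatorname{rank} M_n=r_{n-1}^d$ for every $n\ge 1$.
   Context: $\Pi^d$ is the space of real polynomials in $d$ variables $\mathtt{x}=(x_1,\dots,x_d)$, and $\Pi^d_n$ its subspace of polynomials of total degree at most $n$ (with $\Pi^d_{-1}=\{0\}$). $r_n^d=\binom{n+d-1}{d-1}$ is the number of monomials of total degree $n$. $\mathbb{X}_n$ is the column vector of all monomials $\mathtt{x}^\alpha$, $|\alpha|=n$, arranged in reverse lexicographical order (for $d=2$: $x_1^n,x_1^{n-1}x_2,\dots,x_2^n$). A polynomial system (PS) is a sequence $\{\mathbb{P}_n\}_{n\ge0}$ where $\mathbb{P}_n$ is a column vector of $r_n^d$ polynomials of total degree $n$ that are linearly independent modulo $\Pi^d_{n-1}$. It is monic if, for every $n\ge 0$, all entries of $\mathbb{P}_n-\mathbb{X}_n$ lie in $\Pi^d_{n-1}$ (in particular $\mathbb{P}_0=1$). A moment functional is a linear functional $u:\Pi^d\to\mathbb{R}$;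 it acts entrywise on matrices of polynomials. A PS $\{\mathbb{P}_n\}_{n\ge 0}$ is an orthogonal polynomial system (OPS) with respect to $u$ if $\langle u,\mathbb{P}_n\mathbb{P}_m^t\rangle=0$ for $n\ne m$ and $\langle u,\mathbb{P}_n\mathbb{P}_n^t\rangle=H_n$ is a (symmetric) non-singular matrix for all $n\ge 0$. A monic orthogonal polynomial system is a monic PS that is an OPS with respect to some moment functional. *)

(* Defs.v *)
From HB Require Import structures.
From mathcomp Require Import all_boot all_order all_algebra.
From mathcomp Require Import reals.
From mathcomp Require Import mpoly.

Set Implicit Arguments.
Unset Strict Implicit.
Unset Printing Implicit Defensive.

Import Order.TTheory GRing.Theory Num.Theory.
Local Open Scope ring_scope.

(* r_n^d; the intended value only for 0 < d. *)
Definition nmon (d n : nat) : nat := 'C(n + d - 1, d - 1).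

(* Lexicographic order on exponent vectors (first differing exponent decides),
   reversed: x_1^n comes first, x_d^n last. *)
Definition revlex (d : nat) : rel 'X_{1..d} :=
  fun a b => ((b : seqlexi nat) <= (a : seqlexi nat))%O.

Definition monomials (d n : nat) : seq 'X_{1..d} :=
  sort (@revlex d)
    [seq bmnm m | m : 'X_{1..d < n.+1} <- enum {: 'X_{1..d < n.+1}}
                & mdeg m == n].

(* The default 0%MM is never reached when 0 < d, by size_monomials below. *)
Definition Xvec (R : realType) (d n : nat) : 'cV[{mpoly R[d]}]_(nmon d n) :=
  \col_(i < nmon d n) 'X_[nth 0%MM (monomials d n) i].

(* Membership in Pi^d_{n-1}. Since msize p is 1 + deg p, and msize 0 = 0, this
   is the condition deg p <= n - 1, and it reads p = 0 when n = 0. *)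
Definition deg_lt (R : realType) (d n : nat) (p : {mpoly R[d]}) : Prop :=
  (msize p <= n)%N.

Definition polynomial_system (R : realType) (d : nat)
    (P : forall n : nat, 'cV[{mpoly R[d]}]_(nmon d n)) : Prop :=
  forall n : nat,
    (forall i : 'I_(nmon d n), msize (P n i 0) = n.+1) /\
    (forall c : 'I_(nmon d n) -> R,
       deg_lt n (\sum_(i < nmon d n) c i *: P n i 0) -> forall i, c i = 0).

Definition monic_system (R : realType) (d : nat)
    (P : forall n : nat, 'cV[{mpoly R[d]}]_(nmon d n)) : Prop :=
  forall (n : nat) (i : 'I_(nmon d n)), deg_lt n ((P n - Xvec R d n) i 0).

(* <u, P_n P_m^t>, the functional u acting entrywise. *)
Definition gram (R : realType) (d : nat) (u : {scalar {mpoly R[d]}})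
    (P : forall n : nat, 'cV[{mpoly R[d]}]_(nmon d n)) (n m : nat) :
    'M[R]_(nmon d n, nmon d m) :=
  map_mx u (P n *m (P m)^T).

(* H_n = gram u P n n is automatically symmetric: gram_sym below. *)
Definition is_OPS (R : realType) (d : nat) (u : {scalar {mpoly R[d]}})
    (P : forall n : nat, 'cV[{mpoly R[d]}]_(nmon d n)) : Prop :=
  [/\ polynomial_system P,
      forall n m : nat, n <> m -> gram u P n m = 0
    & forall n : nat, gram u P n n \in unitmx].

Definition monic_OPS (R : realType) (d : nat)
    (P : forall n : nat, 'cV[{mpoly R[d]}]_(nmon d n)) : Prop :=
  [/\ polynomial_system P, monic_system P
    & exists u : {scalar {mpoly R[d]}}, is_OPS u P].

Lemma gram_sym (R : realType) (d : nat) (u : {scalar {mpoly R[d]}})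
    (P : forall n : nat, 'cV[{mpoly R[d]}]_(nmon d n)) (n m : nat) :
  (gram u P n m)^T = gram u P m n.
Proof.
apply/matrixP => i j; rewrite !mxE; congr (u _).
by apply: eq_bigr => k _; rewrite !mxE mulrC.
Qed.

Lemma nmon0 (d : nat) : nmon d 0 = 1%N.
Proof. by rewrite /nmon add0n binn. Qed.

Lemma revlex_total (d : nat) : total (@revlex d).
Proof. by move=> a b; exact: le_total. Qed.

Lemma revlex_trans (d : nat) : transitive (@revlex d).
Proof. by move=> b a c ab bc; exact: le_trans bc ab. Qed.

Lemma revlex_anti (d : nat) : antisymmetric (@revlex d).
Proof.
move=> a b /le_anti/= ab; apply/val_inj/val_inj; exact: esym.
Qed.

Lemma monomials_sorted (d n : nat) : sorted (@revlex d) (monomials d n).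
Proof. exact: (sort_sorted (@revlex_total d)). Qed.

Lemma mem_monomials (d n : nat) (m : 'X_{1..d}) :
  (m \in monomials d n) = (mdeg m == n).
Proof.
rewrite mem_sort; apply/mapP/idP => [[b]|/eqP mn].
  by rewrite mem_filter => /andP[+ _] ->.
have mlt : (mdeg m < n.+1)%N by rewrite mn.
by exists (BMultinom mlt) => //; rewrite mem_filter /= mn eqxx mem_enum.
Qed.

Lemma uniq_monomials (d n : nat) : uniq (monomials d n).
Proof.
rewrite sort_uniq map_inj_uniq; first exact/filter_uniq/enum_uniq.
by move=> a b ab; apply/val_inj.
Qed.

Lemma size_monomials (d n : nat) : (0 < d)%N -> size (monomials d n) = nmon d n.
Proof.
case: d => // d _; rewrite /nmon addnS !subn1 /=.
have -> : 'C(n + d, d) = 'C(n + d, n).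
  by rewrite -[RHS]bin_sub ?leq_addr // addKn.
rewrite -size_basis.
apply/perm_size/uniq_perm; rewrite ?uniq_monomials ?uniq_basis // => m.
by rewrite mem_monomials -basis_cover.
Qed.

Lemma monomials2 (n : nat) :
  monomials 2 n = [seq [multinom [tuple (n - i)%N; i]] | i <- iota 0 n.+1].
Proof.
apply: (sorted_eq (@revlex_trans 2) (@revlex_anti 2)).
- exact: monomials_sorted.
- rewrite sorted_map.
  apply: (sub_in_sorted (P := [pred i | i <= n]%N) (e := ltn)).
  + move=> i j; rewrite !inE => lein lejn /= ij.
    have ltji : (n - j < n - i)%N by rewrite ltn_sub2l // (leq_trans ij).
    by rewrite /revlex /= Order.SeqLexiOrder.lexi_cons !leEnat ltnW //= leqNgt
      ltji.
  + by apply/allP => i; rewrite mem_iota.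
  + exact: iota_ltn_sorted.
- apply: uniq_perm; rewrite ?uniq_monomials //.
    rewrite map_inj_uniq ?iota_uniq // => i j.
    move=> /(congr1 (fun m : 'X_{1..2} => m (inord 1))).
    by rewrite !multinomE !(tnth_nth 0%N) !inordK.
  move=> m; rewrite mem_monomials; apply/eqP/mapP => [mn|[i]].
    exists (m (inord 1)).
      rewrite mem_iota /= add0n ltnS -mn mdegE.
      by rewrite (bigD1 (inord 1)) //= leq_addr.
    have e1 : inord 1 = lift ord0 ord0 :> 'I_2.
      by apply/val_inj; rewrite /= inordK.
    apply/mnmP => i; rewrite multinomE (tnth_nth 0%N) e1 -mn mdegE.
    rewrite !big_ord_recl big_ord0 addn0 addnK.
    by case: i => [[|[|//]] lti] /=; congr (m _); apply/val_inj.
  rewrite mem_iota ltnS => /= lein ->.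
  by rewrite mdegE !big_ord_recl big_ord0 !multinomE !(tnth_nth 0%N) /= addn0
    subnK.
Qed.

(* Main.v *)
Require Import Defs.
From HB Require Import structures.
From mathcomp Require Import all_boot all_order all_algebra.
From mathcomp Require Import reals.
From mathcomp Require Import mpoly.
Local Open Scope ring_scope.

(** Write u and v for functionals making P and Q orthogonal, and H_n for the
    Gram matrix of P_n under u.

    The relation Q_n = P_n + M_n P_(n-1) makes u vanish on Q_n for n >= 2. Any
    functional that vanishes on Q_n for n >= N has the form v (lambda * _) with
    lambda of degree less than N ([functional_as_multiple]), so here
    u = v (lambda * _) with lambda of degree at most 1.

    Let p = c . P_(n-1) be a combination of the entries of P_(n-1). Pairing
    Q_n with p under u gives two expressions of the same vector
    ([moments_related]):
      M_n H_(n-1) c = u (Q_n p) = v (Q_n lambda p).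
    Since lambda p has degree at most n, the right-hand side vanishes exactly
    when the degree drops, that is, when deg (lambda p) < n ([moments_lower],
    [moments_top]). Polynomials have no zero divisors, so two cases remain.
    If lambda is a constant, the degree always drops and every M_n is zero. If
    lambda has degree 1, the degree drops only when deg p < n - 1, which forces
    c = 0, and every M_n is injective. The matrix M_1 tells which case holds. *)

Set Implicit Arguments.
Unset Strict Implicit.
Unset Printing Implicit Defensive.

Import GRing.Theory.

Definition comb (R : realType) (d : nat)
    (P : forall n : nat, 'cV[{mpoly R[d]}]_(nmon d n)) (n : nat)
    (c : 'cV[R]_(nmon d n)) : {mpoly R[d]} :=
  \sum_i c i 0 *: P n i 0.

Arguments comb {R d} P n c.

Definition moments (R : realType) (d : nat) (u : {scalar {mpoly R[d]}})
    (P : forall n : nat, 'cV[{mpoly R[d]}]_(nmon d n)) (n : nat)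
    (q : {mpoly R[d]}) : 'cV[R]_(nmon d n) :=
  \col_i u (P n i 0 * q).

(** * Expansion along a monic system *)

(** In degree n the combination of the entries of P_n whose weights are the
    coefficients of q there has the same homogeneous part as q. *)
Lemma monic_reduce (R : realType) (d : nat)
    (P : forall n : nat, 'cV[{mpoly R[d]}]_(nmon d n)) (n : nat)
    (q : {mpoly R[d]}) :
  (0 < d)%N -> monic_system P -> deg_lt n.+1 q ->
  exists c, deg_lt n (q - comb P n c).
Proof.
move=> d0 mP qn.
exists (\col_i q@_(nth 0%MM (monomials d n) i)).
rewrite /deg_lt msizeE; apply/bigmax_leqP_seq => m + _.
rewrite mcoeff_msupp; apply: contraR; rewrite -leqNgt => nm.
rewrite mcoeffB /comb raddf_sum /=.
(* From degree n upwards an entry of P_n has the coefficients of its monomial. *)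
have coefP i : (P n i 0)@_m = (nth 0%MM (monomials d n) i == m)%:R.
  have := mP n i; rewrite /deg_lt => lt.
  have : (P n - Xvec R d n) i 0 \in [pred p : {mpoly R[d]} | p@_m == 0].
    by rewrite inE mcoeff_eq0 msize_mdeg_ge // (leq_trans lt).
  by rewrite inE !mxE mcoeffB mcoeffX subr_eq0 => /eqP.
move: nm; rewrite leq_eqVlt => /orP[/eqP nm|nm]; last first.
  rewrite big1 => [|i _].
    by rewrite subr0 mcoeff_eq0 msize_mdeg_ge // (leq_trans qn).
  rewrite mcoeffZ coefP; case: eqP => [e|_]; last by rewrite mulr0.
  have := mem_nth 0%MM (s := monomials d n) (n := i).
  rewrite size_monomials // => /(_ (ltn_ord i)).
  by rewrite mem_monomials e gtn_eqF.
have mm : m \in monomials d n by rewrite mem_monomials nm.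
have ltm : (index m (monomials d n) < nmon d n)%N.
  by rewrite -size_monomials // index_mem.
rewrite (bigD1 (Ordinal ltm)) //= big1 => [|i ne].
  by rewrite mcoeffZ coefP mxE /= nth_index // eqxx mulr1 addr0 subrr.
rewrite mcoeffZ coefP; case: eqP => [e|_]; last by rewrite mulr0.
case/eqP: ne; apply/val_inj; rewrite /= -e index_uniq ?uniq_monomials //.
by rewrite size_monomials.
Qed.

Lemma monic_vanish (R : realType) (d : nat)
    (P : forall n : nat, 'cV[{mpoly R[d]}]_(nmon d n))
    (w : {scalar {mpoly R[d]}}) (n : nat) (q : {mpoly R[d]}) :
  (0 < d)%N -> monic_system P ->
  (forall k i, (k < n)%N -> w (P k i 0) = 0) -> deg_lt n q -> w q = 0.
Proof.
move=> d0 mP; elim: n q => [|n IH] q w0 qn.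
  by move: qn; rewrite /deg_lt leqn0 mmeasure_poly_eq0 => /eqP->; rewrite raddf0.
have [c qc] := monic_reduce d0 mP qn.
rewrite -[q](subrK (comb P n c)) raddfD /= IH // => [|k i kn]; last first.
  by apply: w0; rewrite ltnS ltnW.
by rewrite add0r raddf_sum big1 // => i _; rewrite /= linearZ /= w0 // mulr0.
Qed.

Lemma monic_system0 (R : realType) (d : nat)
    (P : forall n : nat, 'cV[{mpoly R[d]}]_(nmon d n)) (i : 'I_(nmon d 0)) :
  (0 < d)%N -> monic_system P -> P 0%N i 0 = 1.
Proof.
move=> d0 mP; have := mP 0%N i.
rewrite /deg_lt leqn0 mmeasure_poly_eq0 !mxE subr_eq0 => /eqP->.
have := mem_nth 0%MM (s := monomials d 0) (n := i).
rewrite size_monomials // => /(_ (ltn_ord i)).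
by rewrite mem_monomials mdeg_eq0 => /eqP->; rewrite mpolyX0.
Qed.

Lemma comb0_const (R : realType) (d : nat)
    (P : forall n : nat, 'cV[{mpoly R[d]}]_(nmon d n)) :
  (0 < d)%N -> monic_system P -> comb P 0 (const_mx 1) = 1.
Proof.
move=> d0 mP; rewrite /comb (eq_bigr (fun=> 1)) => [|i _].
  by rewrite sumr_const card_ord nmon0.
by rewrite mxE scale1r (monic_system0 i).
Qed.

Lemma deg_comb (R : realType) (d : nat)
    (P : forall n : nat, 'cV[{mpoly R[d]}]_(nmon d n)) (n : nat)
    (c : 'cV[R]_(nmon d n)) :
  polynomial_system P -> deg_lt n.+1 (comb P n c).
Proof.
move=> psP; rewrite /deg_lt (leq_trans (msize_sum _ _ _)) //.
apply/bigmax_leqP => i _; rewrite (leq_trans (msizeZ_le _ _)) //.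
by have [-> _] := psP n.
Qed.

(** * Moments of an orthogonal system *)

Lemma momentsB (R : realType) (d : nat) (u : {scalar {mpoly R[d]}})
    (P : forall n : nat, 'cV[{mpoly R[d]}]_(nmon d n)) (n : nat)
    (p q : {mpoly R[d]}) :
  moments u P n (p - q) = moments u P n p - moments u P n q.
Proof. by apply/colP => i; rewrite !mxE mulrBr raddfB. Qed.

Lemma moments_comb (R : realType) (d : nat) (u : {scalar {mpoly R[d]}})
    (P : forall n : nat, 'cV[{mpoly R[d]}]_(nmon d n)) (m n : nat)
    (c : 'cV[R]_(nmon d m)) :
  moments u P n (comb P m c) = gram u P n m *m c.
Proof.
apply/colP => i; rewrite !mxE mulr_sumr raddf_sum; apply: eq_bigr => j _ /=.
by rewrite -scalerAr linearZ /= !mxE big_ord1 mxE mulrC.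
Qed.

Lemma moments_lower (R : realType) (d : nat) (u : {scalar {mpoly R[d]}})
    (P : forall n : nat, 'cV[{mpoly R[d]}]_(nmon d n)) (n : nat)
    (q : {mpoly R[d]}) :
  (0 < d)%N -> monic_system P -> is_OPS u P -> deg_lt n q ->
  moments u P n q = 0.
Proof.
move=> d0 mP [_ oP _] qn; apply/colP => i; rewrite !mxE.
pose w : {scalar {mpoly R[d]}} := u \o (P n i 0 \*o idfun).
apply: (monic_vanish (w := w) d0 mP _ qn) => k j kn /=.
have /matrixP/(_ i j) : gram u P n k = 0 by apply/oP/eqP; rewrite gtn_eqF.
by rewrite !mxE big_ord1 !mxE.
Qed.

(** The leading part c of q contributes the Gram matrix times c to the moments,
    and the rest of q contributes nothing. *)
Lemma moments_top (R : realType) (d : nat) (u : {scalar {mpoly R[d]}})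
    (P : forall n : nat, 'cV[{mpoly R[d]}]_(nmon d n)) (n : nat)
    (q : {mpoly R[d]}) :
  (0 < d)%N -> monic_system P -> is_OPS u P -> deg_lt n.+1 q ->
  moments u P n q = 0 -> deg_lt n q.
Proof.
move=> d0 mP oP qn q0; have [c qc] := monic_reduce d0 mP qn.
have := moments_lower d0 mP oP qc; rewrite momentsB q0 sub0r moments_comb.
have [_ _ /(_ n) uH] := oP.
move=> /eqP; rewrite oppr_eq0 => /eqP /(congr1 (mulmx (invmx (gram u P n n)))).
rewrite mulKmx // mulmx0 => c0; move: qc.
by rewrite c0 /comb big1 ?subr0 // => i _; rewrite mxE scale0r.
Qed.

(** By induction on N, lowering N by a multiple of v: since the Gram matrix is
    invertible, some combination q of the entries of P_N makes v (q * _) agree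
    with w on P_N, and by orthogonality v (q * _) vanishes on the later P_k. *)
Lemma functional_as_multiple (R : realType) (d : nat)
    (v w : {scalar {mpoly R[d]}})
    (P : forall n : nat, 'cV[{mpoly R[d]}]_(nmon d n)) (N : nat) :
  (0 < d)%N -> monic_system P -> is_OPS v P ->
  (forall k i, (N <= k)%N -> w (P k i 0) = 0) ->
  exists2 l : {mpoly R[d]}, deg_lt N l & forall q, w q = v (l * q).
Proof.
move=> d0 mP oP; elim: N w => [|N IH] w w0.
  exists 0 => [|q]; first by rewrite /deg_lt mmeasure0.
  rewrite mul0r raddf0; apply: (monic_vanish d0 mP (n := msize q)) => [k i _|].
    exact: w0.
  exact: leqnn.
have [psP oPP uH] := oP.
pose c := invmx (gram v P N N) *m moments w P N 1.
pose w' : {scalar {mpoly R[d]}} := w \- (v \o (comb P N c \*o idfun)).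
have vc k i : v (comb P N c * P k i 0) = (gram v P k N *m c) i 0.
  by rewrite -moments_comb mxE mulrC.
have [|l lN lE] := IH w'.
  move=> k i; rewrite leq_eqVlt /w' /= vc => /orP[/eqP e|Nk].
    by subst k; rewrite /c mulKVmx // mxE mulr1 subrr.
  by rewrite w0 // oPP ?mul0mx ?mxE ?subr0 //; apply/eqP; rewrite gtn_eqF.
exists (comb P N c + l) => [|q].
  rewrite /deg_lt (leq_trans (msizeD_le _ _)) // geq_max.
  by rewrite (leq_trans lN) // andbT; exact: deg_comb.
by rewrite mulrDl raddfD /= -lE /w' /= addrC subrK.
Qed.

(** * Linearly related systems *)

(** The term P_(n+1) of Q_(n+1) is orthogonal to every polynomial of degree at
    most n, so only the term A P_n contributes. *)
Lemma moments_related (R : realType) (d : nat) (u : {scalar {mpoly R[d]}})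
    (P Q : forall n : nat, 'cV[{mpoly R[d]}]_(nmon d n)) (n : nat)
    (A : 'M[R]_(nmon d n.+1, nmon d n)) (q : {mpoly R[d]}) :
  (0 < d)%N -> monic_system P -> is_OPS u P ->
  Q n.+1 = P n.+1 + map_mx (@mpolyC d R) A *m P n -> deg_lt n.+1 q ->
  moments u Q n.+1 q = A *m moments u P n q.
Proof.
move=> d0 mP oP QE qn; have /colP P0 := moments_lower d0 mP oP qn.
apply/colP => i; rewrite mxE QE !mxE mulrDl raddfD /=.
have := P0 i; rewrite !mxE => ->; rewrite add0r mulr_suml raddf_sum.
apply: eq_bigr => j _ /=.
by rewrite !mxE mul_mpolyC -scalerAl linearZ.
Qed.

Theorem lemma1 (R : realType) (d : nat) (hd : (0 < d)%N)
    (P Q : forall n : nat, 'cV[{mpoly R[d]}]_(nmon d n))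
    (hP : monic_OPS P) (hQ : monic_OPS Q)
    (M : forall n : nat, 'M[R]_(nmon d n, nmon d n.-1))
    (hQ0 : Q 0%N = P 0%N)
    (hPQ : forall n : nat, (1 <= n)%N ->
       Q n = P n + map_mx (@mpolyC d R) (M n) *m P n.-1) :
  (\rank (M 1%N) = 0%N ->
     forall n : nat, (1 <= n)%N -> \rank (M n) = 0%N) /\
  (\rank (M 1%N) = 1%N ->
     forall n : nat, (1 <= n)%N -> \rank (M n) = nmon d n.-1).
Proof.
have [psP mP [u oP]] := hP; have [psQ mQ [v oQ]] := hQ.
have [_ _ uH] := oP.
have rel n q : deg_lt n.+1 q ->
    moments u Q n.+1 q = M n.+1 *m moments u P n q.
  by apply: moments_related => //; exact: hPQ.
have [|l l2 uE] := functional_as_multiple (w := u) (N := 2) hd mQ oQ.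
  case=> [|[|n]] // i _.
  have deg1 : deg_lt n.+1 (1 : {mpoly R[d]}) by rewrite /deg_lt msize1.
  have := rel n.+1 1 (leqW deg1); rewrite (moments_lower hd mP oP deg1) mulmx0.
  by move=> /colP/(_ i); rewrite !mxE mulr1.
have key n (c : 'cV_(nmon d n)) :
    M n.+1 *m (gram u P n n *m c) = moments v Q n.+1 (l * comb P n c).
  rewrite -moments_comb -rel; last exact: deg_comb.
  by apply/colP => i; rewrite !mxE uE mulrCA.
(* Every vector has the form H_n c, because H_n is invertible. *)
have M0 n :
    (forall c : 'cV_(nmon d n), M n.+1 *m (gram u P n n *m c) = 0) ->
    M n.+1 = 0.
  move=> Mc; apply: (can_inj trmxK); apply/row_matrixP => i; rewrite trmx0 row0.
  have := Mc (invmx (gram u P n n) *m (delta_mx 0 i)^T); rewrite mulKVmx //.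
  by move=> /(congr1 trmx); rewrite trmx_mul trmxK trmx0 -rowE.
have deg_lM k n (c : 'cV_(nmon d n)) : deg_lt k.+1 l ->
    deg_lt (k + n).+1 (l * comb P n c).
  rewrite /deg_lt => lk.
  have pn : (msize (comb P n c) <= n.+1)%N by exact: deg_comb.
  have [->|l0] := eqVneq l 0; first by rewrite mul0r mmeasure0.
  have [->|p0] := eqVneq (comb P n c) 0; first by rewrite mulr0 mmeasure0.
  by have := leq_add lk pn; rewrite msizeM // addSn addnS; case: (_ + _)%N.
have const0 n : deg_lt 1 l -> M n.+1 = 0.
  move=> l1; apply: M0 => c; rewrite key; apply: moments_lower => //.
  exact: (deg_lM 0%N).
split=> rM [|n] // _.
  apply/eqP; rewrite mxrank_eq0 const0 //.
  (* The vector v (Q_1 l) = u (Q_1) = M_1 H_0 vanishes, so l is a constant. *)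
  apply: (moments_top hd mQ oQ l2).
  rewrite -[l]mulr1 -(comb0_const hd mP) -key.
  by move/eqP: rM; rewrite mxrank_eq0 => /eqP->; rewrite mul0mx.
have l1 : (1 < msize l)%N.
  by rewrite ltnNge; apply/negP => /(const0 0%N) e; move: rM; rewrite e mxrank0.
have l0 : l != 0 by apply: contraTneq l1 => ->; rewrite mmeasure0.
rewrite -mxrank_tr /=; apply/eqP/inj_row_free => w.
move=> /(congr1 trmx); rewrite trmx_mul trmxK trmx0 => Mw.
pose c := invmx (gram u P n n) *m w^T.
have Hc : gram u P n n *m c = w^T by rewrite mulKVmx.
have lp0 : moments v Q n.+1 (l * comb P n c) = 0 by rewrite -key Hc.
have := moments_top hd mQ oQ (deg_lM 1%N _ c l2) lp0; rewrite /deg_lt => drop.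
(* Multiplying by l raises the degree, so p has lost its top degree too. *)
have pn : deg_lt n (comb P n c).
  have [->|p0] := eqVneq (comb P n c) 0; first by rewrite /deg_lt mmeasure0.
  move: drop; rewrite msizeM // /deg_lt; case: (msize l) l1 => [|[|k]] // _.
  by rewrite addSn /= addSn ltnS; apply/leq_trans/leq_addl.
have [_ /(_ _ pn) c0] := psP n.
apply: trmx_inj; rewrite -Hc trmx0 (_ : c = 0) ?mulmx0 //.
by apply/colP => i; rewrite c0 mxE.
Qed.
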